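(* Let $E$ be a feral topological vector space. Then: (i) $E$ is quasi-complete (hence sequentially complete); (ii) $E$ is a $\mu$-space; (iii) $E$ has the property $(K)$.
   Context: Topological vector spaces (tvs) are assumed Hausdorff. A tvs $E$ is feral if every bounded subset of $E$ is finite-dimensional (i.e. contained in a finite-dimensional linear subspace). A tvs $E$ is quasi-complete if any closed bounded subset of $E$ is complete, and sequentially complete if each Cauchy sequence in $E$ converges to a point of $E$. A subset $A$ of a Tychonoff space $X$ is functionally bounded if $f(A)$ is bounded for every continuous $f:X\to\mathbb{R}$; $X$ is a $\mu$-space if any functionally bounded subset of $X$ is relatively compact (has compact closure). A sequence $(x_n)_n$ converging to $0$ in a tvs $E$ (a null sequence) is a $K$-sequence if every subsequence of $(x_n)_n$ contains a subsequence $(y_n)_n$ such that the series $\sum_n y_n$ converges in $E$. $E$ has the property $(K)$ if every null sequence in $E$ is a $K$-sequence. *)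

(* Defs.v *)
From mathcomp Require Import all_boot all_order all_algebra.
From mathcomp Require Import all_classical all_reals all_analysis.
Set Implicit Arguments.
Unset Strict Implicit.
Unset Printing Implicit Defensive.
Import Order.TTheory GRing.Theory Num.Theory.
Import numFieldNormedType.Exports.
Local Open Scope classical_set_scope.
Local Open Scope ring_scope.

(* [topologicalLmodType K] is used rather than [tvsType K]: the latter imposes
   local convexity, and its uniformity is not required to be the
   translation-invariant one.  Hausdorffness is a separate hypothesis. *)

Section TopologicalVectorSpace.
Context {K : numFieldType} {E : topologicalLmodType K}.
Implicit Types (A : set E) (u : nat -> E).

Definition tvs_bounded A :=
  forall U : set E, nbhs 0 U ->
    exists2 r : K, 0 < r &
      forall t : K, r <= `|t| -> A `<=` [set t *: x | x in U].

Definition lin_span n (e : 'I_n -> E) : set E :=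
  [set x | exists c : 'I_n -> K, x = \sum_(i < n) c i *: e i].

Definition finite_dimensional A :=
  exists (n : nat) (e : 'I_n -> E), A `<=` lin_span e.

(* Cauchy filters for the uniformity whose entourages are the sets
   {(x, y) | x - y \in U}, U a neighbourhood of 0. *)
Definition tvs_cauchy (F : set_system E) :=
  (xy.1 - xy.2) @[xy --> (F, F)] --> (0 : E).

Definition tvs_complete A :=
  forall F : set_system E, ProperFilter F -> F A -> tvs_cauchy F ->
    exists2 x : E, A x & F --> x.

Definition K_sequence u :=
  u @ \oo --> (0 : E) /\
  forall phi : nat -> nat, {homo phi : m n / (m < n)%N} ->
    exists2 psi : nat -> nat, {homo psi : m n / (m < n)%N} &
      exists l : E, series (u \o phi \o psi) @ \oo --> l.

End TopologicalVectorSpace.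

Section Properties.
Context {K : numFieldType} (E : topologicalLmodType K).

Definition feral := forall A : set E, tvs_bounded A -> finite_dimensional A.

Definition quasi_complete :=
  forall A : set E, closed A -> tvs_bounded A -> tvs_complete A.

Definition sequentially_complete :=
  forall u : nat -> E, tvs_cauchy (u @ \oo) -> exists l : E, u @ \oo --> l.

Definition property_K :=
  forall u : nat -> E, u @ \oo --> (0 : E) -> K_sequence u.

End Properties.

Section MuSpace.
Context (R : realType) (X : topologicalType).

Definition functionally_bounded (A : set X) :=
  forall f : X -> R, continuous f -> bounded_set (f @` A).

Definition mu_space :=
  forall A : set X, functionally_bounded A -> compact (closure A).

End MuSpace.

(* Main.v *)
From HB Require Import structures.
Require Import Defs.
From mathcomp Require Import all_boot all_order all_algebra.
From mathcomp Require Import all_classical all_reals all_analysis.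
From mathcomp Require Import complex.
Import Order.TTheory GRing.Theory Num.Theory.
Import numFieldNormedType.Exports.
Set Implicit Arguments.
Unset Strict Implicit.
Unset Printing Implicit Defensive.
Local Open Scope classical_set_scope.
Local Open Scope ring_scope.

(** Everything rests on one fact about a Hausdorff tvs over a locally compact
    field: a bounded finite-dimensional set has compact closure
    ([bounded_finite_dimensional_compact]).  Indeed the coordinates with respect
    to a free family are bounded on a neighbourhood of 0 of its span
    ([lincomb_coord_bounded]), so the set lies in the image of a compact box.
    In a feral space every bounded set therefore has compact closure.

    Quasi-completeness follows since a Cauchy filter containing a compact set
    converges ([compact_tvs_cauchy_cvg]), and sequential completeness since a
    Cauchy sequence is bounded ([cauchy_seq_bounded]).

    For the mu-property it remains to see that a functionally bounded set is
    bounded, which is true in every tvs over an archimedean field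
    ([functionally_bounded_tvs_bounded]).  An unbounded set contains a sequence
    [x n] with a neighbourhood [W] of 0 such that the translates [x n + W] are
    locally finite; the sum of [n] times a continuous bump supported in
    [x n + W] is a continuous function unbounded on the set.

    For property (K), a null sequence is bounded, hence finite-dimensional, and
    its coordinates tend to 0.  Any subsequence contains one whose [k]-th term
    has coordinates at most [2^-k]; its series is Cauchy, so it converges by
    sequential completeness ([property_K_of_complete]).

    The proof is the same over the reals and the complex numbers: the scalars
    form an archimedean field [K] whose balls are contained in compact sets. *)

(** * Neighbourhoods of the origin and bounded sets *)

Section Neighbourhoods.
Context {K : numFieldType} {E : topologicalLmodType K}.
Implicit Types (U W : set E) (x y : E).

Lemma cvgZ_tvs (T : Type) (F : set_system T) {FF : Filter F}
    (f : T -> K) (g : T -> E) (a : K) x :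
  f @ F --> a -> g @ F --> x -> (fun t => f t *: g t) @ F --> a *: x.
Proof.
move=> fa gx; apply: (@continuous2_cvg _ K^o E E F _ f g *:%R a x) fa gx.
exact: (@scale_continuous K E (a, x)).
Qed.

Lemma cvgD_tvs (T : Type) (F : set_system T) {FF : Filter F}
    (f g : T -> E) x y :
  f @ F --> x -> g @ F --> y -> (fun t => f t + g t) @ F --> x + y.
Proof.
move=> fx gy; apply: (@continuous2_cvg _ E E E F _ f g +%R x y) fx gy.
exact: (@add_continuous E (x, y)).
Qed.

Lemma cvg_sum_tvs (T I : Type) (F : set_system T) {FF : Filter F} (s : seq I)
    (f : I -> T -> E) (l : I -> E) :
  (forall i, f i @ F --> l i) ->
  (fun t => \sum_(i <- s) f i t) @ F --> \sum_(i <- s) l i.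
Proof.
move=> fl; elim: s => [|i s IH].
  by rewrite big_nil; under eq_fun do rewrite big_nil; exact: cvg_cst.
by rewrite big_cons; under eq_fun do rewrite big_cons; exact: cvgD_tvs.
Qed.

Lemma nbhs0_translate x U : nbhs x U <-> nbhs (0 : E) [set v | U (x + v)].
Proof.
split=> [Ux|].
  have : (fun v => x + v) @ (0 : E) --> x + 0.
    by apply: cvgD_tvs; [exact: cvg_cst|exact: cvg_id].
  by rewrite addr0 => /(_ U Ux).
have : (fun v => - x + v) @ x --> - x + x.
  by apply: cvgD_tvs; [exact: cvg_cst|exact: cvg_id].
rewrite addNr => h /h; rewrite nbhs_simpl /=; apply: filterS => v /=.
by rewrite addrA subrr add0r.
Qed.

Lemma nbhs0_dilate (a : K) U :
  nbhs (0 : E) U -> nbhs (0 : E) [set v | U (a *: v)].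
Proof.
move=> U0; have : (fun v => a *: v) @ (0 : E) --> a *: 0.
  by apply: cvgZ_tvs; [exact: cvg_cst|exact: cvg_id].
by rewrite scaler0 => /(_ U U0).
Qed.

Definition balanced U := forall a x, `|a| <= 1 -> U x -> U (a *: x).

(** The set of points whose multiples by scalars of norm at most 1 all lie in
    [U] is balanced; continuity of the scaling at the origin makes it a
    neighbourhood. *)
Lemma nbhs0_balanced U : nbhs (0 : E) U ->
  exists2 W, nbhs (0 : E) W & balanced W /\ W `<=` U.
Proof.
move=> U0.
have /= := @scale_continuous K E (0, 0) U; rewrite scaler0 => /(_ U0).
move=> [[D V]] /= [/(@nbhs_ballP K K^o)[d /= d0 dD] V0] DVU.
exists [set x | forall a, `|a| <= 1 -> U (a *: x)]; last first.
  split=> [a x a1 Wx b b1|x /(_ 1)]; last by rewrite scale1r normr1; exact.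
  by rewrite scalerA; apply: Wx; rewrite normrM mulr_ile1.
apply: filterS (nbhs0_dilate (d / 2)^-1 V0) => x /= Vx a a1.
have d20 : 0 < d / 2 by rewrite divr_gt0.
have -> : a *: x = (a * (d / 2)) *: ((d / 2)^-1 *: x).
  by rewrite scalerA mulfK// lt0r_neq0.
apply: (DVU (a * (d / 2), (d / 2)^-1 *: x)); split => //=.
apply: dD; rewrite -ball_normE /ball_ /= sub0r normrN normrM (gtr0_norm d20).
rewrite (@le_lt_trans _ _ (1 * (d / 2)))// ?ler_wpM2r// ?(ltW d20)//.
by rewrite mul1r ltr_pdivrMr// ltr_pMr// ltr1n.
Qed.

Lemma nbhs0_halve U : nbhs (0 : E) U -> exists2 W, nbhs (0 : E) W &
  balanced W /\ forall x y, W x -> W y -> U (x + y).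
Proof.
move=> U0; have /= := @add_continuous E (0, 0) U; rewrite addr0 => /(_ U0).
move=> [[V V']] /= [V0 V'0] VU.
have [W W0 [Wb WV]] := nbhs0_balanced (filterI V0 V'0).
exists W => //; split => // x y /WV[Vx _] /WV[_ Vy].
exact: (VU (x, y)).
Qed.

Lemma balancedN U x : balanced U -> U x -> U (- x).
Proof. by move=> Ub Ux; rewrite -scaleN1r; apply: Ub; rewrite ?normrN1. Qed.

(** For balanced [U] the dilates of [U] grow with the norm of the factor, so
    the factor absorbing a point may be enlarged. *)
Lemma balanced_div (s t : K) U x : balanced U -> 0 < s -> s <= `|t| ->
  U (s^-1 *: x) -> U (t^-1 *: x).
Proof.
move=> Ub s0 st Ux; have t0 : t != 0.
  by rewrite -normr_gt0; exact: lt_le_trans st.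
have -> : t^-1 *: x = (s / t) *: (s^-1 *: x).
  by rewrite scalerA mulrAC divff ?mul1r// lt0r_neq0.
apply: Ub => //; rewrite normrM normfV (gtr0_norm s0).
by rewrite ler_pdivrMr ?mul1r ?normr_gt0.
Qed.

Lemma nbhs0_absorbing U x : nbhs (0 : E) U ->
  exists2 d : K, 0 < d & forall a, `|a| < d -> U (a *: x).
Proof.
move=> U0; have : (fun a => a *: x) @ (0 : K) --> 0 *: x.
  by apply: (@cvgZ_tvs _ (nbhs (0 : K)) _ id); [exact: cvg_id|exact: cvg_cst].
rewrite scale0r => /(_ U U0) /nbhs_ballP[d /= d0 dU]; exists d => // a ad.
by apply: dU; rewrite -ball_normE /ball_ /= sub0r normrN.
Qed.

Lemma nbhs0_absorbing_div U x : nbhs (0 : E) U ->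
  exists2 r : K, 0 < r & forall t, r < `|t| -> U (t^-1 *: x).
Proof.
move=> /(nbhs0_absorbing x)[d d0 dU]; exists d^-1; rewrite ?invr_gt0//.
move=> t dt; apply: dU; rewrite normfV invf_plt ?posrE//.
by apply: lt_trans dt; rewrite invr_gt0.
Qed.

(** A criterion with a single absorbing factor for each balanced neighbourhood,
    instead of all factors of large norm. *)
Lemma tvs_boundedP A : tvs_bounded A <->
  forall U, nbhs (0 : E) U -> balanced U ->
    exists2 r : K, 0 < r & forall x, A x -> U (r^-1 *: x).
Proof.
split=> [Ab U U0 Ub|Ab U /nbhs0_balanced[W W0 [Wb WU]]].
  have [r r0 rA] := Ab U U0; exists r => // x.
  move=> Ax; have [|y Uy <-] := rA r _ x Ax; first by rewrite gtr0_norm.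
  by rewrite scalerA mulVf ?scale1r// lt0r_neq0.
have [r r0 rA] := Ab W W0 Wb; exists r => // t rt x Ax.
exists (t^-1 *: x); first by exact/WU/(balanced_div Wb r0 rt (rA _ Ax)).
by rewrite scalerA divff ?scale1r// -normr_gt0 (lt_le_trans r0).
Qed.

End Neighbourhoods.

(** * Cauchy filters *)

Section Cauchy.
Context {K : numFieldType} {E : topologicalLmodType K}.
Implicit Types (U W : set E) (x y : E) (F : set_system E) (u : nat -> E).

(** A product filter has a basis of rectangles, and a rectangle of members of
    [F] contains the square of their intersection. *)
Lemma tvs_cauchyP F : Filter F -> tvs_cauchy F <->
  forall U, nbhs (0 : E) U ->
    exists2 B, F B & forall x y, B x -> B y -> U (x - y).
Proof.
move=> FF; split=> [Fc U /Fc[[B C] /= [FB FC] BCU]|Fc U /Fc[B FB BU]].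
  exists (B `&` C); first exact: filterI.
  by move=> x y [Bx _] [_ Cy]; exact: (BCU (x, y)).
by exists (B, B) => // -[x y] [/= Bx By]; exact: BU.
Qed.

Lemma tvs_cauchy_seqP u : tvs_cauchy (u @ \oo) <->
  forall U, nbhs (0 : E) U ->
    exists N : nat, forall m n, (N <= m)%N -> (N <= n)%N -> U (u m - u n).
Proof.
rewrite tvs_cauchyP; split=> uc U /uc.
  by move=> [B [N _ NB] BU]; exists N => m n Nm Nn; apply: BU; exact: NB.
move=> [N NU]; exists (u @` [set n | (N <= n)%N]).
  by exists N => // n Nn; exists n.
by move=> _ _ [m Nm <-] [n Nn <-]; exact: NU.
Qed.

Lemma cvg_tvs_cauchy F x : Filter F -> F --> x -> tvs_cauchy F.
Proof.
move=> FF Fx; apply/tvs_cauchyP => U /nbhs0_halve[W W0 [Wb WU]].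
exists [set y | W (- x + y)].
  apply/Fx/nbhs0_translate; apply: filterS W0 => v /=.
  by rewrite addrA addNr add0r.
move=> y z /= Wy Wz; have -> : y - z = (- x + y) + - (- x + z).
  by rewrite opprD opprK addrACA addNr add0r.
by apply: WU => //; exact: balancedN.
Qed.

(** A tail of the sequence lies in a translate of a small balanced [W], and the
    finitely many remaining terms are absorbed by a common multiple of [W]. *)
Lemma cauchy_seq_bounded u : tvs_cauchy (u @ \oo) -> tvs_bounded (range u).
Proof.
move=> /tvs_cauchy_seqP uc; apply/tvs_boundedP => U U0 Ub.
have [W W0 [Wb WU]] := nbhs0_halve U0; have [N NW] := uc W W0.
have prefix n : exists2 r : K, 1 <= r & forall m, (m <= n)%N -> W (r^-1 *: u m).
  elim: n => [|n [r r1 rn]].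
    have [r r0 rW] := nbhs0_absorbing_div (u 0) W0.
    exists (r + 1); first by rewrite lerDr ltW.
    move=> m; rewrite leqn0 => /eqP ->; apply: rW.
    by rewrite gtr0_norm ?ltrDl// addr_gt0.
  have [s s0 sW] := nbhs0_absorbing_div (u n.+1) W0.
  have r0 : 0 < r by exact: lt_le_trans r1.
  exists (r + s); first by rewrite ler_wpDr// ltW.
  have rs0 : 0 < r + s by rewrite addr_gt0.
  move=> m; rewrite leq_eqVlt => /orP[/eqP ->|]; last first.
    rewrite ltnS => /rn; apply: balanced_div => //.
    by rewrite gtr0_norm// lerDl ltW.
  by apply: sW; rewrite gtr0_norm// ltrDr.
have [r r1 rN] := prefix N; have r0 : 0 < r by exact: lt_le_trans r1.
exists r => // _ [m _ <-]; have [Nm|/ltnW mN] := leqP N m.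
  have -> : u m = u N + (u m - u N) by rewrite addrC subrK.
  rewrite scalerDr; apply: WU; first exact: rN.
  apply: Wb; last exact: NW.
  by rewrite normfV invf_le1 ?gtr0_norm.
rewrite -[_ *: _]addr0; apply: WU; first exact: rN.
exact: nbhs_singleton.
Qed.

(** A Cauchy filter converges to each of its cluster points, and compactness
    provides one. *)
Lemma compact_tvs_cauchy_cvg F (A : set E) : ProperFilter F ->
  compact A -> F A -> tvs_cauchy F -> exists2 x, A x & F --> x.
Proof.
move=> FF Ac FA /tvs_cauchyP Fc; have [x [Ax xF]] := Ac F FF FA.
exists x => // U /nbhs0_translate /nbhs0_halve[W W0 [Wb WU]].
have [B FB BW] := Fc W W0.
have [b [Bb /= Wb']] : B `&` [set y | W (- x + y)] !=set0.
  apply: xF => //; apply/nbhs0_translate; apply: filterS W0 => v /=.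
  by rewrite addrA addNr add0r.
change (F U); apply: filterS FB => y By.
have -> : y = x + ((- x + b) + (y - b)).
  by rewrite -(addrA (- x)) addNKr addrC subrK.
by apply: WU => //; exact: BW.
Qed.

Lemma complete_of_compact_closure :
  (forall A : set E, tvs_bounded A -> compact (closure A)) ->
  quasi_complete E /\ sequentially_complete E.
Proof.
move=> Ecomp; split=> [A Acl Ab F FF FA Fc|u uc].
  apply: compact_tvs_cauchy_cvg FA Fc.
  by rewrite (closure_id A).1//; exact: Ecomp.
have uccl := Ecomp _ (cauchy_seq_bounded uc).
have [|x _ ux] := compact_tvs_cauchy_cvg _ uccl _ uc.
  by exists 0%N => // n _; apply: subset_closure; exists n.
by exists x.
Qed.

End Cauchy.

(** * Finite-dimensional bounded sets *)

(** The order of a [numFieldType] is partial (think of complex numbers), but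
    norms are real, hence pairwise comparable. *)
Lemma exists_max_norm (K : numFieldType) n (c : 'I_n -> K) (i0 : 'I_n) :
  exists i, forall j, `|c j| <= `|c i|.
Proof.
pose ord (i j : 'I_n) := `|c j| <= `|c i|.
have ord_refl : reflexive ord by move=> i; exact: lexx.
have ord_trans : transitive ord by move=> j i k ji kj; exact: le_trans kj ji.
have ord_total : total ord.
  by move=> i j; exact: real_leVge (normr_real _) (normr_real _).
have [i _ imax] :=
  @extremumP _ _ ord i0 xpredT id ord_refl ord_trans ord_total isT.
by exists i => j; exact: imax.
Qed.

Section FiniteDimension.
Context {K : numFieldType} {E : topologicalLmodType K}.
Implicit Types (A U W : set E).

Definition lincomb n (e : 'I_n -> E) (c : 'I_n -> K) : E :=
  \sum_(i < n) c i *: e i.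

Definition lin_free n (e : 'I_n -> E) :=
  forall c, lincomb e c = 0 -> forall i, c i = 0.

Lemma lincombZ n (e : 'I_n -> E) (a : K) c :
  lincomb e (fun i => a * c i) = a *: lincomb e c.
Proof. by rewrite scaler_sumr; apply: eq_bigr => i _; rewrite scalerA. Qed.

(** A nontrivial linear relation lets one vector be eliminated from the spanning
    family; the induction on its length stops at a free family. *)
Lemma finite_dimensional_free A : finite_dimensional A ->
  exists n (e : 'I_n -> E), lin_free e /\ A `<=` lin_span e.
Proof.
move=> [n [e Ae]]; elim: n => [|n IH] in e Ae *.
  by exists 0%N, e; split => // c _ [].
have [[i ce0]|] := pselect (exists i, exists2 c, lincomb e c = 0 & c i != 0).
  move: ce0 => [c ce0 ci0]; apply: (IH (fun j => e (lift i j))) => x /Ae[b ->].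
  have ei : e i = \sum_(j < n) (- (c i)^-1 * c (lift i j)) *: e (lift i j).
    move: ce0; rewrite /lincomb (bigD1_ord i)//= => /eqP.
    rewrite addr_eq0 => /eqP cei.
    rewrite -[LHS](scalerK ci0) cei scalerN scaler_sumr -sumrN.
    by apply: eq_bigr => j _; rewrite scalerA mulNr scaleNr.
  exists (fun j => b i * (- (c i)^-1 * c (lift i j)) + b (lift i j)).
  rewrite (bigD1_ord i)//= {1}ei scaler_sumr -big_split/=.
  by apply: eq_bigr => j _; rewrite scalerA scalerDl.
move=> efree; exists n.+1, e; split => // c ce0 i; apply/eqP/negPn/negP => ci0.
by apply: efree; exists i, c.
Qed.

Lemma lincomb_continuous n (e : 'I_n -> E) :
  continuous (lincomb e : prod_topology (fun _ : 'I_n => K) -> E).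
Proof.
move=> c; apply: (@cvg_sum_tvs K E _ _ (nbhs c) _ _
  (fun i (c : prod_topology (fun _ : 'I_n => K)) => c i *: e i)) => i.
apply: (@cvgZ_tvs K E _ (nbhs c) _ (fun d => d i)); last exact: cvg_cst.
exact: (@proj_continuous _ (fun _ : 'I_n => K) i c).
Qed.

(* Local compactness of the scalars, through compact sets containing the balls
   rather than the balls themselves: only upper bounds matter here. *)
Hypothesis compK :
  forall r : K, exists2 C : set K, compact C & forall x, `|x| <= r -> C x.

Lemma compact_lincomb n (e : 'I_n -> E) (C : 'I_n -> set K) :
  (forall i, compact (C i)) ->
  compact (lincomb e @` [set c | forall i, C i (c i)]).
Proof.
move=> Cc; apply: (@continuous_compact (prod_topology (fun _ : 'I_n => K))).
  exact/continuous_subspaceT/lincomb_continuous.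
exact: tychonoff.
Qed.

Hypothesis sepE : hausdorff_space E.

(** This says that the coordinates are continuous on the span of a free family.
    Were the maximal coordinate [c i] of norm at least 1, division by it would
    move the combination into the set [S i] of combinations with [i]-th
    coordinate 1 and the others in a compact set containing the unit ball.
    Each [S i] is a continuous image of a compact product, hence closed, and avoids 0 by freeness, so a
    balanced neighbourhood of 0 avoids all of them. *)
Lemma lincomb_coord_bounded n (e : 'I_n -> E) : lin_free e ->
  exists2 U, nbhs (0 : E) U &
    forall c, U (lincomb e c) -> forall i, `|c i| < 1.
Proof.
move=> efree; have [C Cc C1] := compK 1.
(* [D i] freezes the [i]-th coordinate at 1, so that [S i] covers one face of
   the unit sphere for the maximum norm. *)
pose D (i j : 'I_n) : set K := if j == i then [set 1] else C.
pose S i := lincomb e @` [set c | forall j, D i j (c j)].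
have Scl i : closed (S i).
  apply: (compact_closed sepE); apply: (@compact_lincomb _ _ (D i)) => j.
  by rewrite /D; case: ifP => // _; exact: compact_set1.
have S0 i : ~ S i 0.
  move=> [c cS /efree /(_ i) ci0];
  have := cS i; rewrite /D eqxx /= ci0 => /esym/eqP.
  by rewrite oner_eq0.
have : nbhs (0 : E) [set x | forall i, (~` S i) x].
  apply: filter_forall => i.
  by apply: open_nbhs_nbhs; split; [exact: closed_openC|exact: S0].
move=> /nbhs0_balanced[U U0 [Ub US]]; exists U => // c Uc i0.
have [i cmax] := exists_max_norm c i0.
apply: le_lt_trans (cmax i0) _; rewrite real_ltNge ?normr_real// ?real1//.
apply/negP => ci1; have ci0 : c i != 0.
  by rewrite -normr_gt0 (lt_le_trans ltr01).
have ciV : `|(c i)^-1| <= 1 by rewrite normfV invf_le1// normr_gt0.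
apply: (US _ (Ub _ _ ciV Uc) i); exists (fun j => (c i)^-1 * c j); last first.
  exact: lincombZ.
move=> j; rewrite /D; case: eqP => [->|_]; first by rewrite /= mulVf.
by apply: C1; rewrite normrM normfV mulrC ler_pdivrMr ?normr_gt0 ?mul1r.
Qed.

(** The coordinates of the points of [A] are bounded, so [A] lies in the compact
    image of a product of balls. *)
Lemma bounded_finite_dimensional_compact A :
  tvs_bounded A -> finite_dimensional A -> compact (closure A).
Proof.
move=> /tvs_boundedP Ab /finite_dimensional_free[n [e [efree Ae]]].
have [V /nbhs0_balanced[U U0 [Ub UV]] Ve] := lincomb_coord_bounded efree.
have [r r0 rA] := Ab U U0 Ub; have [C Cc Cr] := compK r.
pose S := lincomb e @` [set c | forall i, C (c i)].
have Sc : compact S by apply: (@compact_lincomb _ _ (fun=> C)).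
have AS : A `<=` S.
  move=> x Ax; have [c xc] := Ae x Ax; exists c => // i; apply: Cr.
  have := UV _ (rA x Ax); rewrite xc -lincombZ => /Ve /(_ i) /ltW.
  by rewrite normrM normfV (gtr0_norm r0) mulrC ler_pdivrMr// mul1r.
apply: (subclosed_compact _ Sc); first exact: closed_closure.
have /closure_id -> : closed S by exact: (compact_closed sepE Sc).
exact: closure_subset.
Qed.

End FiniteDimension.

(** * Null sequences and convergent series *)

Lemma increasing_selection (P : nat -> nat -> Prop) :
  (forall k, exists N, forall m, (N <= m)%N -> P k m) ->
  exists2 psi : nat -> nat, {homo psi : m n / (m < n)%N} &
    forall k, P k (psi k).
Proof.
move=> /choice[N NP]; exists (fun k => \sum_(j < k.+1) N j + k)%N.
  move=> m n; elim: n => // n IH; rewrite ltnS leq_eqVlt.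
  move=> /orP[/eqP ->|/IH mn].
    by rewrite [in ltnRHS]big_ord_recr/= addnS ltnS leq_add2r leq_addr.
  apply: ltn_trans mn _.
  by rewrite [in ltnRHS]big_ord_recr/= addnS ltnS leq_add2r leq_addr.
move=> k; apply: NP; rewrite big_ord_recr/=; apply: leq_trans (leq_addr _ _).
exact: leq_addl.
Qed.

(** The induction is on the sharper bound [2 * 2^-m - 2 * 2^-n]. *)
Lemma norm_sum_geometric (K : numFieldType) (a : nat -> K) m n :
  (forall k, `|a k| <= 2^-1 ^+ k) ->
  `|\sum_(m <= k < n) a k| <= 2 * 2^-1 ^+ m.
Proof.
move=> ak; have [nm|/ltnW/subnKC <-] := leqP n m.
  by rewrite big_geq// normr0 mulr_ge0// exprn_ge0// invr_ge0.
set p := (n - m)%N.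
suff : `|\sum_(m <= k < m + p) a k| <= 2 * 2^-1 ^+ m - 2 * 2^-1 ^+ (m + p).
  move=> /le_trans; apply; rewrite gerBl mulr_ge0// exprn_ge0// invr_ge0//.
elim: p => [|p IH]; first by rewrite addn0 subrr big_geq ?normr0.
rewrite addnS big_nat_recr ?leq_addr//=.
apply: le_trans (ler_normD _ _) _; apply: le_trans (lerD IH (ak _)) _.
rewrite exprS mulrA divff// mul1r -addrA lerD2l [in leLHS]mulr_natl.
by rewrite [in leLHS]mulr2n opprD addrNK.
Qed.

Section PropertyK.
Context {K : numFieldType} {E : topologicalLmodType K}.

Hypothesis archK : forall x : K, 0 < x -> exists n : nat, x < n%:R.
Hypothesis compK :
  forall r : K, exists2 C : set K, compact C & forall x, `|x| <= r -> C x.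
Hypothesis sepE : hausdorff_space E.

(** Geometrically small coordinates give Cauchy coordinate series, and the
    difference of two partial sums is a finite linear combination of differences
    of the coordinate series. *)
Lemma lincomb_series_cauchy n (e : 'I_n -> E) (c : nat -> 'I_n -> K) :
  (forall k i, `|c k i| <= 2^-1 ^+ k) ->
  tvs_cauchy (series (lincomb e \o c) @ \oo).
Proof.
move=> ck; apply/tvs_cauchy_seqP => U U0.
pose T i (mp : nat * nat) := series (c ^~ i) mp.1 - series (c ^~ i) mp.2.
have T0 i : T i @ (\oo, \oo) --> (0 : K).
  apply/(@cvgr0Pnorm_lt _ K) => d d0.
  have d20 : 0 < 2 / d by rewrite divr_gt0.
  have [N dN] := archK d20.
  exists ([set m | (N <= m)%N], [set m | (N <= m)%N]).
    by split; exists N.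
  have Tle m p : (N <= m)%N -> (m <= p)%N -> `|T i (p, m)| < d.
    move=> Nm mp; rewrite /T /= sub_series mp.
    apply: le_lt_trans (norm_sum_geometric _ _ (ck ^~ i)) _.
    have : (2 : K) * 2^-1 ^+ m <= 2 * N.+1%:R^-1.
      rewrite ler_pM2l// exprVn lef_pV2 ?posrE ?exprn_gt0// -natrX ler_nat.
      by apply: leq_trans (ltn_expl m (isT : 1 < 2)%N); rewrite ltnS.
    move=> /le_lt_trans; apply; rewrite ltr_pdivrMr//.
    move: dN; rewrite ltr_pdivrMr// => /lt_le_trans; apply.
    by rewrite mulrC ler_pM2l// ler_nat.
  move=> [m p] [/= Nm Np]; have [mp|/ltnW pm] := leqP m p.
    by rewrite /T /= distrC; exact: Tle.
  exact: Tle.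
have Te i : (fun mp => T i mp *: e i) @ (\oo, \oo) --> (0 : K) *: e i.
  by apply: cvgZ_tvs; [exact: T0|exact: cvg_cst].
have := @cvg_sum_tvs K E _ _ _ _ (index_enum 'I_n) _ _ Te.
rewrite [X in _ --> X]big1; last by move=> i _; rewrite scale0r.
move=> /(_ _)/(_ U U0)[[B C]] /= [[N1 _ NB] [N2 _ NC] BCU].
exists (maxn N1 N2) => m p; rewrite !geq_max => /andP[m1 _] /andP[_ p2].
have := BCU (m, p) (conj (NB _ m1) (NC _ p2)) => /=; congr U.
rewrite /series/= /lincomb [X in _ = X - _]exchange_big/=.
rewrite [X in _ = _ - X]exchange_big/=.
rewrite -sumrB; apply: eq_bigr => i _.
by rewrite -!scaler_suml -scalerBl.
Qed.

(** A null sequence lives in the span of a free family, where its coordinates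
    tend to 0.  A subsequence whose [k]-th term has coordinates at most [2^-k]
    has a Cauchy series. *)
Lemma property_K_of_complete :
  (forall u : nat -> E, u @ \oo --> (0 : E) -> finite_dimensional (range u)) ->
  sequentially_complete E -> property_K E.
Proof.
move=> fd Ecomp u u0; split => // phi phi_mono.
have [n [e [efree ue]]] := finite_dimensional_free (fd u u0).
have /choice[c uc] : forall m, exists c, u m = lincomb e c.
  by move=> m; apply: ue; exists m.
have [U U0 Ue] := lincomb_coord_bounded compK sepE efree.
have small k : exists N, forall m, (N <= m)%N ->
    forall i, `|c (phi m) i| <= 2^-1 ^+ k.
  have [N _ NU] := u0 _ (nbhs0_dilate (2 ^+ k) U0).
  exists N => m Nm i; have phim : (m <= phi m)%N.
    elim: m {Nm} => // m; move/leq_ltn_trans; apply; exact: phi_mono.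
  have := NU _ (leq_trans Nm phim); rewrite /= uc -lincombZ => /Ue /(_ i) /ltW.
  rewrite normrM gtr0_norm ?exprn_gt0// mulrC exprVn.
  by rewrite -ler_pdivlMr ?exprn_gt0// div1r.
have [psi psi_mono csmall] := increasing_selection small.
exists psi => //; have -> : u \o phi \o psi = lincomb e \o (c \o phi \o psi).
  by apply/funext => k /=; rewrite uc.
by apply: Ecomp; exact: lincomb_series_cauchy.
Qed.

End PropertyK.

(** * Functionally bounded sets *)

Section TranslationUniformity.
Context {K : numFieldType} (E : topologicalLmodType K).

(** A copy of [E] to carry the translation-invariant uniformity, which makes
    Urysohn functions of uniform spaces available on [E]. *)
Definition translation_uniform : Type := E.

HB.instance Definition _ := Choice.copy translation_uniform E.

Definition translation_entourage :
    set_system (translation_uniform * translation_uniform) :=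
  fun P => exists2 U : set E, nbhs (0 : E) U &
    forall x y : E, U (x - y) -> P (x, y).

Lemma translation_entourage_filter : Filter translation_entourage.
Proof.
split; first by exists setT => //; exact: filterT.
  move=> P Q [U U0 UP] [V V0 VQ]; exists (U `&` V); first exact: filterI.
  by move=> x y [Ux Vx]; split; [exact: UP|exact: VQ].
by move=> P Q PQ [U U0 UP]; exists U => // x y /UP /PQ.
Qed.

Lemma translation_entourage_diagonal P :
  translation_entourage P -> diagonal `<=` P.
Proof.
move=> [U U0 UP] [x y] xy; have -> : x = y := xy; apply: UP.
by rewrite subrr; exact: nbhs_singleton.
Qed.

Lemma translation_entourage_inv P :
  translation_entourage P -> translation_entourage P^-1%relation.
Proof.
move=> [U /nbhs0_balanced[W W0 [Wb WU]] UP]; exists W => // x y Wxy.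
by apply: UP; apply: WU; rewrite -opprB; exact: balancedN.
Qed.

Lemma translation_entourage_split P : translation_entourage P ->
  exists2 Q, translation_entourage Q & (Q \; Q)%relation `<=` P.
Proof.
move=> [U /nbhs0_halve[W W0 [_ WU]] UP].
exists [set xy : E * E | W (xy.1 - xy.2)]; first by exists W.
move=> [x y] [z /= Wxz Wzy]; apply: UP.
by rewrite -(subrK z x) -addrA; exact: WU.
Qed.

HB.instance Definition _ := isUniform.Build translation_uniform
  translation_entourage_filter translation_entourage_diagonal
  translation_entourage_inv translation_entourage_split.

(** The complement of [W] and the origin are separated by the entourage of the
    pairs whose difference is in [W]. *)
Lemma bump_function (R : realType) (W : set E) : nbhs (0 : E) W ->
  exists phi : E -> R, [/\ continuous phi, phi 0 = 1,
    forall x, 0 <= phi x & forall x, ~ W x -> phi x = 0].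
Proof.
move=> W0; have sepW : uniform_separator (~` W) [set (0 : E)].
  exists (Uniform.class translation_uniform).
  exists [set xy : E * E | W (xy.1 - xy.2)]; split.
  - by exists W.
  - rewrite -subset0 => -[x y] [[/= nWx ->]].
    by rewrite subr0.
  - move=> x A [P [U /nbhs0_balanced[V V0 [Vb VU]] UP] PA].
    apply/nbhs0_translate; apply: filterS V0 => v Vv; apply: PA.
    apply/mem_set/UP/VU; rewrite opprD addrA subrr add0r.
    exact: balancedN.
have phi0 := @Urysohn_sub0 E R _ _ sepW.
have phi1 := @Urysohn_sub1 E R _ _ sepW.
exists (Urysohn (~` W) [set 0]); split.
- exact: Urysohn_continuous.
- by apply: phi1; exists 0.
- move=> x; have : `[0, 1]%classic (@Urysohn E R (~` W) [set 0] x).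
    by apply: Urysohn_range; exists x.
  by rewrite /= in_itv/= => /andP[].
- by move=> x nWx; apply: phi0; exists x.
Qed.

End TranslationUniformity.

Section FunctionallyBounded.
Context (R : realType) {K : numFieldType} (E : topologicalLmodType K).

Hypothesis archK : forall x : K, 0 < x -> exists n : nat, x < n%:R.

(** Take [W + W + W] inside a [U] that fails to absorb [A], and [x n] in [A]
    outside [t *: U] for some [t] of norm at least [n + 1].  A fixed
    [y + W + W] is contained in [t *: U] as soon as [t *: W] contains [y], so it
    contains [x n] for finitely many [n] only. *)
Lemma unbounded_escaping_sequence (A : set E) : ~ tvs_bounded A ->
  exists2 W : set E, nbhs (0 : E) W & balanced W /\
    exists2 x : nat -> E, (forall n, A (x n)) &
      forall y, exists N, forall n, (N <= n)%N ->
        forall w w', W w -> W w' -> x n <> y + w + w'.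
Proof.
move=> /existsNP[U /not_implyP[U0 nU]].
have /choice[xt] : forall n, exists xt : E * K,
    [/\ A xt.1, n.+1%:R <= `|xt.2| & ~ U (xt.2^-1 *: xt.1)].
  move=> n; apply: contrapT => /forallNP An; apply: nU.
  exists n.+1%:R => // t nt x Ax.
  have t0 : t != 0 by rewrite -normr_gt0 (lt_le_trans _ nt).
  exists (t^-1 *: x); last by rewrite scalerA divff ?scale1r.
  by apply: contrapT => nUx; apply: (An (x, t)).
move=> /all_and3[Ax tn nUx].
have [V V0 [_ VU]] := nbhs0_halve U0; have [W W0 [Wb WV]] := nbhs0_halve V0.
exists W => //; split => //; exists (fst \o xt) => // y.
have [r r0 rW] := nbhs0_absorbing_div y W0; have [N rN] := archK r0.
exists N => n Nn w w' Ww Ww' /= xE; apply: (nUx n).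
have tW z : W z -> W ((xt n).2^-1 *: z).
  apply: Wb; rewrite normfV invf_le1.
    by rewrite (le_trans _ (tn n))// ler1n.
  by rewrite (lt_le_trans _ (tn n)).
rewrite xE scalerDr; apply: VU.
  rewrite scalerDr; apply: WV; last exact: tW.
  apply: rW; apply: (lt_le_trans rN); apply: le_trans (tn n).
  by rewrite ler_nat leqW.
rewrite -[_ *: w']add0r; apply: WV; last exact: tW.
exact: nbhs_singleton.
Qed.

(** Along an escaping sequence [x], the bumps [k%:R * phi (z - x k)] form a
    locally finite family: those not vanishing on [y + W] have index below
    [N y].  Their sum is therefore continuous, and it is at least [n] at [x n],
    which belongs to [A]. *)
Lemma functionally_bounded_tvs_bounded (A : set E) :
  functionally_bounded R A -> tvs_bounded A.
Proof.
move=> Af; apply: contrapT => /unbounded_escaping_sequence.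
move=> [W W0 [Wb [x Ax /choice[N xN]]]].
have [phi [phi_cont phi0 phi_ge0 phiW]] := bump_function R W0.
pose F n z : R := \sum_(k < n) k%:R * phi (z - x k).
have Fcont n : continuous (F n).
  move=> z; apply: (@cvg_sum_tvs R R^o _ _ (nbhs z) _ (index_enum 'I_n)
    (fun (k : 'I_n) z => k%:R * phi (z - x k))) => k.
  apply: cvgM; first exact: cvg_cst.
  apply: (@continuous_comp _ _ _ (fun z : E => z - x k) phi);
    last exact: phi_cont.
  by apply: cvgD_tvs; [exact: cvg_id|exact: cvg_cst].
have FN y z n : W (z - y) -> (N y <= n)%N -> F n z = F (N y) z.
  move=> Wzy; rewrite /F => Nn.
  rewrite -!(big_mkord xpredT (fun k => k%:R * phi (z - x k))).
  rewrite (big_cat_nat _ Nn)//= [X in _ + X]big1_seq ?addr0// => k.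
  rewrite mem_index_iota => /andP[_ /andP[Nk _]]; rewrite phiW ?mulr0// => Wzk.
  apply: (xN y k Nk (z - y) (- (z - x k))) => //; first exact: balancedN.
  by rewrite addrCA subrr addr0 opprB addrC subrK.
(* The sum of all bumps: the terms of index at least [N z] vanish at [z]. *)
pose f z := F (N z) z.
have fF y z : W (z - y) -> f z = F (N y) z.
  move=> Wzy; rewrite /f -(FN y z (maxn (N y) (N z)))// ?leq_maxl//.
  by rewrite (FN z)// ?leq_maxr// subrr; exact: nbhs_singleton.
have fcont : continuous f.
  move=> y; have fFy : \forall z \near y, F (N y) z = f z.
    apply/nbhs0_translate; apply: filterS W0 => v Wv /=.
    by rewrite (fF y)// addrC addKr.
  rewrite /continuous_at (fF y y) ?subrr; last exact: nbhs_singleton.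
  exact: cvg_trans (near_eq_cvg fFy) (Fcont (N y) y).
have fx n : n%:R <= f (x n).
  have nN : (n < N (x n))%N.
    rewrite ltnNge; apply/negP => /(xN (x n) n) /(_ 0 0).
    by rewrite !addr0; apply => //; exact: nbhs_singleton.
  rewrite /f /F (bigD1 (Ordinal nN))//= subrr phi0 mulr1 lerDl.
  by apply: sumr_ge0 => k _; rewrite mulr_ge0.
have [M [_ /(_ (M + 1))]] := Af f fcont; rewrite ltrDl ltr01 => /(_ isT) fM.
have := fM (f (x (Num.truncn (M + 1)).+1)).
rewrite /= => /(_ (ex_intro2 _ _ _ (Ax _) erefl)) /(le_trans (ler_norm _)).
by rewrite leNgt (lt_le_trans (truncnS_gt _) (fx _)).
Qed.

End FunctionallyBounded.

(** * The real and complex scalars *)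

Lemma real_archimedean (R : realType) (x : R) :
  0 < x -> exists n : nat, x < n%:R.
Proof. by exists (Num.truncn x).+1; exact: truncnS_gt. Qed.

Lemma real_ball_compact (R : realType) (r : R) :
  exists2 C : set R, compact C & forall x, `|x| <= r -> C x.
Proof.
exists `[- r, r]%classic; first exact: segment_compact.
by move=> x; rewrite ler_norml /= in_itv.
Qed.

Section Complex.
Variable R : realType.
Local Open Scope complex_scope.

(** The norm topology is attached to the carriers of [numFieldType] structures,
    not to [R[i]] itself. *)
Definition complex_numField : numFieldType := R[i].
Local Notation C := complex_numField.

Lemma complex_archimedean (x : R[i]) : 0 < x -> exists n : nat, x < n%:R.
Proof.
rewrite ltcE => /andP[/eqP Imx /real_archimedean[n xn]].
by exists n; rewrite -(rmorph_nat (real_complex R)) ltcE /= Imx eqxx.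
Qed.

Lemma normc_real (a : R) : `|a%:C| = `|a|%:C.
Proof. by rewrite normc_def/= expr0n addr0 sqrtr_sqr. Qed.

Lemma real_complex_continuous : continuous (real_complex R : R -> C).
Proof.
move=> a; apply/(@cvgrPdist_lt C C) => e.
rewrite ltcE => /andP[/eqP Ime e0]; near=> b.
rewrite -[_ - _](rmorphB (real_complex R)) [`|_|]normc_real ltcE/= Ime eqxx /=.
by near: b; exact: cvgr_dist_lt.
Unshelve. all: by end_near. Qed.

Lemma complex_ball_compact (r : C) :
  exists2 B : set C, compact B & forall x, `|x| <= r -> B x.
Proof.
pose f (z : R * R) : C :=
  (real_complex R z.1 : C) + ('i : C) * (real_complex R z.2 : C).
pose I : set R := `[- complex.Re r, complex.Re r]%classic.
exists (f @` (I `*` I)).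
  apply: continuous_compact; last first.
    by apply: compact_setX; exact: segment_compact.
  apply: continuous_subspaceT => z; rewrite /f.
  apply: (@cvgD C C).
    apply: (@continuous_comp _ _ C fst); first exact: cvg_fst.
    exact: real_complex_continuous.
  apply: (@cvgM C); first exact: cvg_cst.
  apply: (@continuous_comp _ _ C snd); first exact: cvg_snd.
  exact: real_complex_continuous.
move=> x xr; exists (complex.Re x, complex.Im x); last first.
  by rewrite /f [RHS]complexE.
have : Num.sqrt (complex.Re x ^+ 2 + complex.Im x ^+ 2) <= complex.Re r.
  by move: xr; rewrite [`|_|]normc_def lecE/= => /andP[].
move=> /(le_trans _) xr'; split; rewrite /I /= in_itv/= -ler_norml -sqrtr_sqr;
  by apply/xr'/ler_wsqrtr; rewrite ?lerDl ?lerDr sqr_ge0.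
Qed.

End Complex.

(** * Feral spaces *)

Lemma feral_properties (R : realType) (K : numFieldType)
    (archK : forall x : K, 0 < x -> exists n : nat, x < n%:R)
    (compK : forall r : K,
       exists2 C : set K, compact C & forall x, `|x| <= r -> C x)
    (E : topologicalLmodType K) :
  hausdorff_space E -> feral E ->
  [/\ quasi_complete E, sequentially_complete E, mu_space R E & property_K E].
Proof.
move=> sepE feralE.
have bounded_compact (A : set E) : tvs_bounded A -> compact (closure A).
  by move=> Ab; apply: bounded_finite_dimensional_compact => //; exact: feralE.
have [qcE scE] := complete_of_compact_closure bounded_compact.
split=> //.
  by move=> A /(functionally_bounded_tvs_bounded archK); exact: bounded_compact.
apply: property_K_of_complete => // u u0.
by apply/feralE/cauchy_seq_bounded; exact: cvg_tvs_cauchy u0.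
Qed.

Theorem proposition2p9 (R : realType) :
  (forall E : topologicalLmodType R, hausdorff_space E -> feral E ->
     [/\ quasi_complete E, sequentially_complete E,
         mu_space R E & property_K E]) /\
  (forall E : topologicalLmodType R[i], hausdorff_space E -> feral E ->
     [/\ quasi_complete E, sequentially_complete E,
         mu_space R E & property_K E]).
Proof.
split=> E.
  exact: (@feral_properties R R (@real_archimedean R) (@real_ball_compact R)).
exact: (@feral_properties R (complex_numField R) (@complex_archimedean R)
  (@complex_ball_compact R)).
Qed.
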